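(* Let $f_1=f_1(x^3)$ and $f_2=f_2(x^3)$ be nowhere zero smooth functions on $\mathbb R^3$ depending only on $x^3$, let $f_3=k_3\in\mathbb R\setminus\{0\}$ be constant, and let $g=\frac{1}{f_1^2}dx^1\otimes dx^1+\frac{1}{f_2^2}dx^2\otimes dx^2+\frac{1}{k_3^2}dx^3\otimes dx^3$. Then the vector field $V=\sum_{k=1}^3V^kE_k$, with $V^1,V^2,V^3$ smooth functions on $\mathbb R^3$, is a Killing vector field on $(\mathbb R^3,g)$ if and only if all of the following six equations hold: $$f_1\frac{\partial V^1}{\partial x^1}=k_3\frac{f_1'}{f_1}V^3,$$ $$f_2\frac{\partial V^2}{\partial x^2}=k_3\frac{f_2'}{f_2}V^3,$$ $$\frac{\partial V^3}{\partial x^3}=0,$$ $$f_1\frac{\partial V^2}{\partial x^1}=-f_2\frac{\partial V^1}{\partial x^2},$$ $$f_2\frac{\partial V^3}{\partial x^2}+k_3\frac{\partial V^2}{\partial x^3}+k_3\frac{f_2'}{f_2}V^2=0,$$ $$k_3\frac{\partial V^1}{\partial x^3}+f_1\frac{\partial V^3}{\partial x^1}+k_3\frac{f_1'}{f_1}V^1=0.$$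
   Context: $x^1,x^2,x^3$ are the standard coordinates on $\mathbb R^3$. The orthonormal frame for $g$ is $E_1=f_1\frac{\partial}{\partial x^1}$, $E_2=f_2\frac{\partial}{\partial x^2}$, $E_3=k_3\frac{\partial}{\partial x^3}$. A prime on $f_1$ or $f_2$ denotes the derivative with respect to $x^3$. A vector field $V$ is a Killing vector field if $\pounds_V g=0$, i.e. $V(g(X,Y))-g([V,X],Y)-g(X,[V,Y])=0$ for all tangent vector fields $X,Y$ on $\mathbb R^3$. *)

(* Defs.v *)
From HB Require Import structures.
From mathcomp Require Import all_boot all_order all_algebra.
From mathcomp Require Import all_classical all_reals all_analysis.
Set Implicit Arguments.
Unset Strict Implicit.
Unset Printing Implicit Defensive.
Import Order.TTheory GRing.Theory Num.Theory.
Import numFieldNormedType.Exports.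
Local Open Scope ring_scope.

(* Points of R^n are row vectors. A vector field is given by its components
   in the coordinate frame, (X p) 0 i being the coefficient of d/dx^i at p. *)

Notation scalar_field R n := ('rV[R]_n -> R).
Notation vector_field R n := ('rV[R]_n -> 'rV[R]_n).
Notation tensor_field02 R n := ('rV[R]_n -> 'rV[R]_n -> 'rV[R]_n -> R).

(* The standard coordinates x^1, x^2, x^3 of R^3 have indices 0, 1, 2. *)
Definition x1 : 'I_3 := @Ordinal 3 0 isT.
Definition x2 : 'I_3 := @Ordinal 3 1 isT.
Definition x3 : 'I_3 := @Ordinal 3 2 isT.

Section Calculus.
Context {R : realType} {n : nat}.

Definition coord_vec (i : 'I_n) : 'rV[R]_n := delta_mx 0 i.

Definition coord_form (i : 'I_n) (u : 'rV[R]_n) : R := u 0 i.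

Definition tensor (a b : 'rV[R]_n -> R) (u v : 'rV[R]_n) : R := a u * b v.

Definition partial (i : 'I_n) (f : scalar_field R n) : scalar_field R n :=
  fun p => 'D_(coord_vec i) f p.

Fixpoint Ck (k : nat) (f : scalar_field R n) : Prop :=
  if k is m.+1 then
    (forall p, differentiable f p) /\ (forall i, Ck m (partial i f))
  else continuous f.

Definition smooth (f : scalar_field R n) : Prop := forall k, Ck k f.

Definition smooth_vf (X : vector_field R n) : Prop :=
  forall i, smooth (fun p => X p 0 i).

Definition vf_apply (X : vector_field R n) (f : scalar_field R n) :
  scalar_field R n := fun p => \sum_(i < n) X p 0 i * partial i f p.

(* [X, Y]^i = X(Y^i) - Y(X^i) *)
Definition lie_bracket (X Y : vector_field R n) : vector_field R n :=
  fun p => \row_(i < n) (vf_apply X (fun q => Y q 0 i) p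
                         - vf_apply Y (fun q => X q 0 i) p).

Definition lie_derivative (V : vector_field R n) (g : tensor_field02 R n)
    (X Y : vector_field R n) : scalar_field R n :=
  fun p => vf_apply V (fun q => g q (X q) (Y q)) p
           - g p (lie_bracket V X p) (Y p) - g p (X p) (lie_bracket V Y p).

Definition killing (g : tensor_field02 R n) (V : vector_field R n) : Prop :=
  smooth_vf V /\
  forall X Y : vector_field R n, smooth_vf X -> smooth_vf Y ->
    forall p, lie_derivative V g X Y p = 0.

End Calculus.

Section Frame.
Context {R : realType}.

Definition only_x3 (f : scalar_field R 3) : Prop :=
  forall p q : 'rV[R]_3, p 0 x3 = q 0 x3 -> f p = f q.

Definition diag_metric (f1 f2 f3 : scalar_field R 3) : tensor_field02 R 3 :=
  fun p u v =>
    1 / f1 p ^+ 2 * tensor (coord_form x1) (coord_form x1) u v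
  + 1 / f2 p ^+ 2 * tensor (coord_form x2) (coord_form x2) u v
  + 1 / f3 p ^+ 2 * tensor (coord_form x3) (coord_form x3) u v.

(* V^1 E_1 + V^2 E_2 + V^3 E_3 for the orthonormal frame E_i = f_i d/dx^i *)
Definition frame_vf (f1 f2 f3 V1 V2 V3 : scalar_field R 3) :
  vector_field R 3 :=
  fun p => V1 p *: (f1 p *: coord_vec x1)
         + V2 p *: (f2 p *: coord_vec x2)
         + V3 p *: (f3 p *: coord_vec x3).

End Frame.

(* Main.v *)
Require Import Defs.
From HB Require Import structures.
From mathcomp Require Import all_boot all_order all_algebra.
From mathcomp Require Import all_classical all_reals all_analysis.
From mathcomp Require Import ring.
Set Implicit Arguments.
Unset Strict Implicit.
Unset Printing Implicit Defensive.
Import Order.TTheory GRing.Theory Num.Theory.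
Import numFieldNormedType.Exports.
Local Open Scope ring_scope.

(** For a diagonal metric [g = \sum_i h_i dx^i (x) dx^i] on R^n the Lie
    derivative is tensorial: the derivatives of [X] and [Y] cancel and
    [(L_V g)(X, Y) = \sum_(i, j) X^i Y^j L_ij], where [L_ij] is
    [delta_ij V(h_i) + h_i d_j V^i + h_j d_i V^j]
    ([lie_derivative_diagonal_metric]). Testing on the constant coordinate
    fields shows that [V] is Killing iff every [L_ij] vanishes
    ([killing_diagonal_metric]). When [h_i = f_i^-2] and [V^i = v_i f_i], the
    product [f_i f_j L_ij] is the component of [L_V g] on the orthonormal frame
    [f_i d/dx^i], and the Leibniz rule expresses it through the derivatives of
    the [v_i] and [f_i] ([frame_lie_coefE]). In dimension 3, with [f_1] and
    [f_2] depending on [x^3] alone and [f_3] constant, only the derivatives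
    [d_3 f_1] and [d_3 f_2] survive, and the six independent components of
    the symmetric tensor [L_V g] are the six equations, up to nonzero constant
    factors on the diagonal. *)

(** * Partial derivatives *)

Section PartialDerivatives.
Context {R : realType} {n : nat}.
Implicit Types (f g : scalar_field R n) (X V : vector_field R n).

Lemma partialD f g i p : differentiable f p -> differentiable g p ->
  partial i (fun q => f q + g q) p = partial i f p + partial i g p.
Proof. by move=> df dg; apply: deriveD; apply: diff_derivable. Qed.

Lemma partialM f g i p : differentiable f p -> differentiable g p ->
  partial i (fun q => f q * g q) p = f p * partial i g p + g p * partial i f p.
Proof. by move=> df dg; apply: deriveM; apply: diff_derivable. Qed.

Lemma partial_cst (c : R) (i : 'I_n) p : partial i (fun=> c) p = 0.
Proof. exact: derive_cst. Qed.

Lemma partial_sum m (F : 'I_m -> scalar_field R n) i p :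
  (forall k, differentiable (F k) p) ->
  partial i (fun q => \sum_(k < m) F k q) p = \sum_(k < m) partial i (F k) p.
Proof.
move=> dF; rewrite /partial -derive_sum; last first.
  by move=> k; apply: diff_derivable.
by congr derive; apply/funext => q; rewrite fct_sumE.
Qed.

Lemma partial_expVn2 f i p : f p != 0 -> differentiable f p ->
  partial i (fun q => (f q ^+ 2)^-1) p = - 2 * partial i f p / f p ^+ 3.
Proof.
move=> f0 df.
have df2 : differentiable (fun q => f q ^+ 2) p by exact: differentiableM.
rewrite /partial deriveV ?expf_neq0 //; last exact: diff_derivable.
have -> : 'D_(coord_vec i) (fun q => f q ^+ 2) p = 2 * f p * partial i f p.
  by have := partialM i df df; rewrite /partial => ->; ring.
by rewrite /partial /GRing.scale /=; field; rewrite f0.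
Qed.

(** A function that is constant along the coordinate line through [p] has a
    vanishing partial derivative there. *)
Lemma partial_eq0 f i p :
  (forall t : R, f (t *: coord_vec i + p) = f p) -> partial i f p = 0.
Proof.
move=> fE; rewrite /partial /derive.
under eq_fun do rewrite /= fE subrr scaler0.
exact: lim_cst.
Qed.

Lemma differentiable_smooth f p : smooth f -> differentiable f p.
Proof. by move=> /(_ 1%N) []. Qed.

Lemma Ck_pred k f : Ck k.+1 f -> Ck k f.
Proof.
elim: k f => [|k IH] f [df Cf].
  by move=> p; exact: differentiable_continuous.
by split=> // i; exact/IH/Cf.
Qed.

Lemma CkD k f g : Ck k f -> Ck k g -> Ck k (fun q => f q + g q).
Proof.
elim: k f g => [|k IH] f g.
  by move=> cf cg p; apply: continuousD; [exact: cf|exact: cg].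
move=> [df Cf] [dg Cg]; split; first by move=> p; exact: differentiableD.
move=> i; have -> : partial i (fun q => f q + g q)
    = fun q => partial i f q + partial i g q.
  by apply/funext => q; rewrite partialD.
by apply: IH; [exact: Cf|exact: Cg].
Qed.

Lemma CkM k f g : Ck k f -> Ck k g -> Ck k (fun q => f q * g q).
Proof.
elim: k f g => [|k IH] f g.
  by move=> cf cg p; apply: continuousM; [exact: cf|exact: cg].
move=> Cf' Cg'; have [Cf0 Cg0] := (Ck_pred Cf', Ck_pred Cg').
move: Cf' Cg' => [df Cf] [dg Cg]; split.
  by move=> p; exact: differentiableM.
move=> i; have -> : partial i (fun q => f q * g q)
    = fun q => f q * partial i g q + g q * partial i f q.
  by apply/funext => q; rewrite partialM.
by apply: CkD; apply: IH; [exact: Cf0|exact: Cg|exact: Cg0|exact: Cf].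
Qed.

Lemma smooth_cst (c : R) : smooth ((fun=> c) : scalar_field R n).
Proof.
move=> k; elim: k c => [|k IH] c; first by move=> p; exact: cst_continuous.
split=> [p|i]; first exact: differentiable_cst.
have -> : partial i (fun=> c) = fun=> 0; last exact: IH.
by apply/funext => q; rewrite partial_cst.
Qed.

Lemma smoothM f g : smooth f -> smooth g -> smooth (fun q => f q * g q).
Proof. by move=> sf sg k; exact: CkM. Qed.

Lemma vf_applyM X f g p : differentiable f p -> differentiable g p ->
  vf_apply X (fun q => f q * g q) p
  = f p * vf_apply X g p + g p * vf_apply X f p.
Proof.
move=> df dg; rewrite /vf_apply !mulr_sumr -big_split /=.
by apply: eq_bigr => i _; rewrite partialM//; ring.
Qed.

Lemma vf_apply_sum m X (F : 'I_m -> scalar_field R n) p :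
  (forall k, differentiable (F k) p) ->
  vf_apply X (fun q => \sum_(k < m) F k q) p = \sum_(k < m) vf_apply X (F k) p.
Proof.
move=> dF; rewrite /vf_apply exchange_big /=.
by apply: eq_bigr => i _; rewrite partial_sum// mulr_sumr.
Qed.

End PartialDerivatives.

(** * Lie derivative of a diagonal metric *)

Section DiagonalMetric.
Context {R : realType} {n : nat}.
Implicit Types (h f v : 'I_n -> scalar_field R n) (V X Y : vector_field R n).

(** The metric [\sum_i h_i dx^i (x) dx^i]. *)
Definition diagonal_metric h : tensor_field02 R n :=
  fun p u w => \sum_(i < n) h i p * (u 0 i * w 0 i).

(** The component of the Lie derivative along [V] of [diagonal_metric h] on
    the coordinate fields [d/dx^i] and [d/dx^j]. *)
Definition lie_coef h V (i j : 'I_n) (p : 'rV[R]_n) : R :=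
  (i == j)%:R * vf_apply V (h i) p
  + h i p * partial j (fun q => V q 0 i) p
  + h j p * partial i (fun q => V q 0 j) p.

Lemma lie_derivative_diagonal_metric h V X Y p :
  (forall i, differentiable (h i) p) ->
  (forall i, differentiable (fun q => X q 0 i) p) ->
  (forall i, differentiable (fun q => Y q 0 i) p) ->
  lie_derivative V (diagonal_metric h) X Y p
  = \sum_(i < n) \sum_(j < n) X p 0 i * Y p 0 j * lie_coef h V i j p.
Proof.
move=> dh dX dY; rewrite /lie_derivative /diagonal_metric.
have dXY i : differentiable (fun q => X q 0 i * Y q 0 i) p.
  exact: differentiableM.
rewrite vf_apply_sum; last by move=> i; exact: differentiableM.
rewrite -!sumrB.
have -> : \sum_(i < n) \sum_(j < n) X p 0 i * Y p 0 j * lie_coef h V i j p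
  = \sum_(i < n) X p 0 i * Y p 0 i * vf_apply V (h i) p
  + \sum_(i < n) h i p * X p 0 i * vf_apply Y (fun q => V q 0 i) p
  + \sum_(i < n) h i p * Y p 0 i * vf_apply X (fun q => V q 0 i) p.
  (* In the last of the three sums the roles of the two indices are swapped. *)
  have -> : \sum_(i < n) h i p * Y p 0 i * vf_apply X (fun q => V q 0 i) p
    = \sum_(i < n) \sum_(j < n)
        X p 0 i * Y p 0 j * (h j p * partial i (fun q => V q 0 j) p).
    rewrite exchange_big; apply: eq_bigr => i _; rewrite /vf_apply mulr_sumr.
    by apply: eq_bigr => j _; ring.
  rewrite -!big_split /=; apply: eq_bigr => i _.
  have -> : X p 0 i * Y p 0 i * vf_apply V (h i) p
    = \sum_(j < n) X p 0 i * Y p 0 j * ((i == j)%:R * vf_apply V (h i) p).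
    rewrite (bigD1 i)//= eqxx mul1r big1 ?addr0// => j /negbTE ji.
    by rewrite eq_sym ji mul0r mulr0.
  rewrite [in X in _ + X + _]/vf_apply mulr_sumr -!big_split /=.
  by apply: eq_bigr => j _; rewrite /lie_coef; ring.
rewrite -!big_split /=; apply: eq_bigr => i _.
by rewrite vf_applyM// vf_applyM// !mxE; ring.
Qed.

Lemma killing_diagonal_metric h V :
  (forall i p, differentiable (h i) p) -> smooth_vf V ->
  killing (diagonal_metric h) V <-> forall i j p, lie_coef h V i j p = 0.
Proof.
move=> dh sV; split=> [[_ KV] i j p|L0]; last first.
  split=> // X Y sX sY p; rewrite lie_derivative_diagonal_metric//.
  - by apply: big1 => i _; apply: big1 => j _; rewrite L0 mulr0.
  - by move=> i; exact: differentiable_smooth.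
  - by move=> i; exact: differentiable_smooth.
have sc k : smooth_vf (fun=> coord_vec k : 'rV[R]_n).
  by move=> l; exact: smooth_cst.
have := KV _ _ (sc i) (sc j) p; rewrite lie_derivative_diagonal_metric//.
rewrite (bigD1 i)//= [X in _ + X]big1 ?addr0; last first.
  move=> k /negbTE ki; apply: big1 => l _.
  by rewrite !mxE ki andbF !mul0r.
rewrite (bigD1 j)//= [X in _ + X]big1 ?addr0; last first.
  move=> l /negbTE lj.
  by rewrite !mxE lj andbF mulr0 mul0r.
by rewrite !mxE !eqxx !mul1r.
Qed.

(** The component on the orthonormal frame fields [f_i d/dx^i] and
    [f_j d/dx^j] of the Lie derivative of [\sum_i f_i^-2 dx^i (x) dx^i] along
    [\sum_i v_i f_i d/dx^i]. *)
Definition frame_lie_coef f v (i j : 'I_n) (p : 'rV[R]_n) : R :=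
  f j p * partial j (v i) p + f j p * v i p * partial j (f i) p / f i p
  + (f i p * partial i (v j) p + f i p * v j p * partial i (f j) p / f j p)
  - (i == j)%:R * 2 / f i p * \sum_(k < n) v k p * f k p * partial k (f i) p.

Lemma frame_lie_coefE f v V i j p :
  (forall k, f k p != 0) -> (forall k, differentiable (f k) p) ->
  (forall k, differentiable (v k) p) ->
  (forall q k, V q 0 k = v k q * f k q) ->
  frame_lie_coef f v i j p
  = f i p * f j p * lie_coef (fun k q => (f k q ^+ 2)^-1) V i j p.
Proof.
move=> f0 df dv VE; rewrite /frame_lie_coef /lie_coef.
have VF k : (fun q => V q 0 k) = fun q => v k q * f k q.
  by apply/funext => q; rewrite VE.
rewrite !VF !partialM//.
have -> : vf_apply V (fun q => (f i q ^+ 2)^-1) p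
  = - 2 / f i p ^+ 3 * \sum_(k < n) v k p * f k p * partial k (f i) p.
  rewrite /vf_apply mulr_sumr; apply: eq_bigr => k _.
  by rewrite VE partial_expVn2//; ring.
have := f0 i; have := f0 j.
by case: (eqVneq i j) => [->|_] fj fi /=; field; rewrite ?fi ?fj.
Qed.

(** Multiplying by [f_i f_j], which is nowhere zero, passes from coordinate
    components to frame components. *)
Lemma killing_frame f v V :
  (forall k p, f k p != 0) -> (forall k, smooth (f k)) ->
  (forall k, smooth (v k)) ->
  (forall q k, V q 0 k = v k q * f k q) ->
  killing (diagonal_metric (fun k q => (f k q ^+ 2)^-1)) V
  <-> forall i j p, frame_lie_coef f v i j p = 0.
Proof.
move=> f0 sf sv VE.
have df k p : differentiable (f k) p by exact: differentiable_smooth.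
have dv k p : differentiable (v k) p by exact: differentiable_smooth.
have sV : smooth_vf V.
  move=> k; have -> : (fun q => V q 0 k) = fun q => v k q * f k q.
    by apply/funext => q; rewrite VE.
  exact: smoothM.
have dh k p : differentiable (fun q => (f k q ^+ 2)^-1) p.
  apply: differentiableV; last by rewrite expf_neq0.
  exact: differentiableM.
rewrite killing_diagonal_metric//.
have E i j p := @frame_lie_coefE f v V i j p (f0^~ p) (df^~ p) (dv^~ p) VE.
split=> H i j p; first by rewrite E H mulr0.
by have /eqP := H i j p; rewrite E !mulf_eq0 !(negbTE (f0 _ _)) /= => /eqP.
Qed.

End DiagonalMetric.

(** * The three-dimensional case *)

Section ThreeDimensional.
Context {R : realType}.

(** The family of three functions indexed by [x1], [x2], [x3]. *)
Definition triple (a b c : scalar_field R 3) (i : 'I_3) : scalar_field R 3 :=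
  if i == x1 then a else if i == x2 then b else c.

Lemma sum_x123 (F : 'I_3 -> R) : \sum_(i < 3) F i = F x1 + F x2 + F x3.
Proof.
rewrite !big_ord_recr big_ord0 /= add0r.
by congr (F _ + F _ + F _); apply/val_inj.
Qed.

Lemma forall_x123 (P : 'I_3 -> Prop) : P x1 -> P x2 -> P x3 -> forall i, P i.
Proof.
move=> P1 P2 P3 [[|[|[|//]]] Hi].
- by rewrite (_ : Ordinal Hi = x1)//; apply/val_inj.
- by rewrite (_ : Ordinal Hi = x2)//; apply/val_inj.
- by rewrite (_ : Ordinal Hi = x3)//; apply/val_inj.
Qed.

Lemma diag_metricE (f1 f2 f3 : scalar_field R 3) :
  diag_metric f1 f2 f3
  = diagonal_metric (fun k q => (triple f1 f2 f3 k q ^+ 2)^-1).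
Proof.
apply/funext => p; apply/funext => u; apply/funext => w.
by rewrite /diag_metric /diagonal_metric sum_x123 !div1r.
Qed.

Lemma frame_vfE (f1 f2 f3 V1 V2 V3 : scalar_field R 3) q k :
  frame_vf f1 f2 f3 V1 V2 V3 q 0 k
  = triple V1 V2 V3 k q * triple f1 f2 f3 k q.
Proof.
by elim/forall_x123: k; rewrite /frame_vf !mxE /triple /=; ring.
Qed.

Lemma partial_only_x3 (f : scalar_field R 3) i p :
  only_x3 f -> i != x3 -> partial i f p = 0.
Proof.
move=> fx3 /negbTE i3; apply: partial_eq0 => t; apply: fx3.
by rewrite !mxE eq_sym i3 andbF mulr0 add0r.
Qed.

End ThreeDimensional.

Theorem lemma2p1 (R : realType) (f1 f2 : 'rV[R]_3 -> R) (k3 : R)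
  (f1_smooth : smooth f1) (f2_smooth : smooth f2)
  (f1_x3 : only_x3 f1) (f2_x3 : only_x3 f2)
  (f1_neq0 : forall p, f1 p != 0) (f2_neq0 : forall p, f2 p != 0)
  (k3_neq0 : k3 != 0)
  (V1 V2 V3 : 'rV[R]_3 -> R)
  (V1_smooth : smooth V1) (V2_smooth : smooth V2) (V3_smooth : smooth V3) :
  let f3 : 'rV[R]_3 -> R := fun=> k3 in
  let g := diag_metric f1 f2 f3 in
  let V := frame_vf f1 f2 f3 V1 V2 V3 in
  let f1' := partial x3 f1 in
  let f2' := partial x3 f2 in
  killing g V <->
  (forall p, f1 p * partial x1 V1 p = k3 * (f1' p / f1 p) * V3 p) /\
  (forall p, f2 p * partial x2 V2 p = k3 * (f2' p / f2 p) * V3 p) /\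
  (forall p, partial x3 V3 p = 0) /\
  (forall p, f1 p * partial x1 V2 p = - f2 p * partial x2 V1 p) /\
  (forall p, f2 p * partial x2 V3 p + k3 * partial x3 V2 p
             + k3 * (f2' p / f2 p) * V2 p = 0) /\
  (forall p, k3 * partial x3 V1 p + f1 p * partial x1 V3 p
             + k3 * (f1' p / f1 p) * V1 p = 0).
Proof.
move=> f3 g V f1' f2'.
pose f := triple f1 f2 f3; pose v := triple V1 V2 V3.
have KV : killing g V <-> forall i j p, frame_lie_coef f v i j p = 0.
  rewrite /g diag_metricE; apply: killing_frame.
  - by elim/forall_x123.
  - by elim/forall_x123 => //=; exact: smooth_cst.
  - by elim/forall_x123.
  - exact: frame_vfE.
have d13 p : partial x1 f3 p = 0 by exact: partial_cst.
have d23 p : partial x2 f3 p = 0 by exact: partial_cst.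
have d33 p : partial x3 f3 p = 0 by exact: partial_cst.
have d11 p : partial x1 f1 p = 0 by exact: partial_only_x3.
have d21 p : partial x2 f1 p = 0 by exact: partial_only_x3.
have d12 p : partial x1 f2 p = 0 by exact: partial_only_x3.
have d22 p : partial x2 f2 p = 0 by exact: partial_only_x3.
have d := (d13, d23, d33, d11, d21, d12, d22).
have L11 p : frame_lie_coef f v x1 x1 p
    = 2 * (f1 p * partial x1 V1 p - k3 * (f1' p / f1 p) * V3 p).
  by rewrite /frame_lie_coef sum_x123 /f /v /triple /= !d /f1' /f3; ring.
have L22 p : frame_lie_coef f v x2 x2 p
    = 2 * (f2 p * partial x2 V2 p - k3 * (f2' p / f2 p) * V3 p).
  by rewrite /frame_lie_coef sum_x123 /f /v /triple /= !d /f2' /f3; ring.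
have L33 p : frame_lie_coef f v x3 x3 p = 2 * k3 * partial x3 V3 p.
  by rewrite /frame_lie_coef sum_x123 /f /v /triple /= !d /f3; ring.
have L12 p : frame_lie_coef f v x1 x2 p
    = f1 p * partial x1 V2 p - - f2 p * partial x2 V1 p.
  by rewrite /frame_lie_coef sum_x123 /f /v /triple /= !d; ring.
have L23 p : frame_lie_coef f v x2 x3 p
    = f2 p * partial x2 V3 p + k3 * partial x3 V2 p
      + k3 * (f2' p / f2 p) * V2 p.
  by rewrite /frame_lie_coef sum_x123 /f /v /triple /= !d /f2' /f3; ring.
have L13 p : frame_lie_coef f v x1 x3 p
    = k3 * partial x3 V1 p + f1 p * partial x1 V3 p
      + k3 * (f1' p / f1 p) * V1 p.
  by rewrite /frame_lie_coef sum_x123 /f /v /triple /= !d /f1' /f3; ring.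
have Lsym i j p : frame_lie_coef f v i j p = frame_lie_coef f v j i p.
  rewrite /frame_lie_coef eq_sym; case: (eqVneq j i) => [->//|_].
  by rewrite !mul0r; congr (_ - _); rewrite addrC.
rewrite KV; split=> [L0|[E11 [E22 [E33 [E12 [E23 E13]]]]]].
  split=> [p|].
    by have /eqP := L0 x1 x1 p; rewrite L11 mulf_eq0 pnatr_eq0 subr_eq0 => /eqP.
  split=> [p|].
    by have /eqP := L0 x2 x2 p; rewrite L22 mulf_eq0 pnatr_eq0 subr_eq0 => /eqP.
  split=> [p|].
    have /eqP := L0 x3 x3 p.
    by rewrite L33 !mulf_eq0 pnatr_eq0 (negbTE k3_neq0) => /eqP.
  split=> [p|].
    by have /eqP := L0 x1 x2 p; rewrite L12 subr_eq0 => /eqP.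
  by split=> p; [rewrite -L23|rewrite -L13].
elim/forall_x123; elim/forall_x123 => p.
- by rewrite L11 E11 subrr mulr0.
- by rewrite L12 E12 subrr.
- by rewrite L13.
- by rewrite Lsym L12 E12 subrr.
- by rewrite L22 E22 subrr mulr0.
- by rewrite L23.
- by rewrite Lsym L13.
- by rewrite Lsym L23.
- by rewrite L33 E33 mulr0.
Qed.
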